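(* Let $(d_n)_{n\ge1}$ be a fixed sequence of integers $d_n>1$, let $(\varepsilon_n)_{n\ge1}$ be a fixed sequence with $\varepsilon_n\in\{0,1,\dots,d_n-1\}$, and let $s_0=\Delta^{-D}_{\varepsilon_1\varepsilon_2\ldots\varepsilon_n\ldots}$. The set $M_{s_0}$ of all incomplete sums of this alternating Cantor series is: 1. the one-element set $\{0\}$, if $s_0=0$; 2. a finite set, if the condition $\varepsilon_n\ne0$ holds for only a finite set of values of $n$; 3. the segment $\left[-\frac23;\frac13\right]$, if $d_n=2$ for all $n\in\mathbb N$ and $s_0=-\frac13$; 4. a union of a finite number of segments, if there is only a finite set of indices $m_1<m_2<\dots<m_{k_0}$ ($k_0$ a fixed number) for which $d_{m_i}\neq 2$ (so $d_n=2$ for all other $n$), and $s_0=\Delta^{-D}_{\varepsilon_1\varepsilon_2\ldots\varepsilon_{m_{k_0}}(1)}$ (i.e. $\varepsilon_n=1$ for all $n>m_{k_0}$); 5. a continuous (that is, of the cardinality of the continuum), perfect, nowhere dense set of zero Lebesgue measure, if $s_0\ne0$ and $d_n>2$ for infinitely many values of $n$.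
   Context: For digits $\varepsilon_n\in\{0,1,\dots,d_n-1\}$, $$\Delta^{-D}_{\varepsilon_1\varepsilon_2\ldots\varepsilon_n\ldots}=\sum_{n=1}^{\infty}\frac{(-1)^n\varepsilon_n}{d_1d_2\cdots d_n}.$$ Parentheses in a subscript denote a period repeated infinitely often. Given the fixed sequences $(d_n)$ and $(\varepsilon_n)$, an incomplete sum of the series $s_0=\sum_{n\ge1}\frac{(-1)^n\varepsilon_n}{d_1d_2\cdots d_n}$ is a number $\sum_{n\ge1}\frac{(-1)^n\delta_n}{d_1d_2\cdots d_n}$ with $\delta_n\in\{0,\varepsilon_n\}$ for every $n$. The set of all incomplete sums is $$M_{s_0}=\left\{\Delta^{-D}_{\delta_1\delta_2\ldots\delta_n\ldots}:\ \delta_n\in\{0,\varepsilon_n\}\text{ for all }n\in\mathbb N\right\}.$$ A segment is a closed interval.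
   Formalization: In item 5 it is additionally assumed that ε_n ≠ 0 for infinitely many n; without this item 5 is false (d_n = 3 for all n, ε_1 = 1, all other ε_n = 0 gives s_0 = -1/3 but M = {0, -1/3}). *)

(* Defs.v *)
From mathcomp Require Export all_boot all_order all_algebra.
From mathcomp Require Export all_classical all_reals all_analysis.

Set Implicit Arguments.
Unset Strict Implicit.
Unset Printing Implicit Defensive.

Import Order.TTheory GRing.Theory Num.Theory.
Import numFieldNormedType.Exports.

Local Open Scope classical_set_scope.
Local Open Scope ring_scope.

(* Sequences are indexed from 1: the value at index 0 is a dummy which is
   never used. *)

(* The limit exists whenever 1 < d n and eps n < d n for all n >= 1, as the
   series is then absolutely convergent. *)
Definition alt_cantor_series {R : realType} (d eps : nat -> nat) : R :=
  limn (fun N : nat => \sum_(1 <= n < N.+1)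
    ((-1) ^+ n * (eps n)%:R / \prod_(1 <= k < n.+1) (d k)%:R) : R).

Definition incomplete_sums {R : realType} (d eps : nat -> nat) : set R :=
  [set alt_cantor_series d delta | delta in
    [set delta : nat -> nat |
      forall n, (0 < n)%N -> delta n = 0%N \/ delta n = eps n]].

Definition is_segment {R : realType} (A : set R) : Prop :=
  exists a b : R, a < b /\ A = `[a, b]%classic.

Definition finite_union_of_segments {R : realType} (A : set R) : Prop :=
  exists F : set (set R),
    [/\ finite_set F, (forall S, F S -> is_segment S) & A = \bigcup_(S in F) S].

Definition nowhere_dense {T : topologicalType} (A : set T) : Prop :=
  interior (closure A) = set0.

(* Main.v *)
Require Import Defs.
From mathcomp Require Import ring lra zify measurable_realfun.

Import Order.TTheory GRing.Theory Num.Theory.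
Import numFieldNormedType.Exports.
Local Open Scope classical_set_scope.
Local Open Scope ring_scope.

(** Everything rests on self-similarity. Write A(d, e) for the sum of the
    alternating Cantor series, P_k = d_1 ... d_k, and let primes denote
    sequences with their first k terms dropped. Then
      A(d, e) = (partial sum up to k) + ((-1)^k / P_k) A(d', e'),
    which is [alt_cantor_splitD]; for k = 1 this reads
    A(d, e) = - (e_1 + A(d', e')) / d_1. The last form gives |A| <= 1, then
    A <= 1/2, then A > -1. These strict bounds yield what is needed about
    uniqueness of expansions: A = 0 forces all digits to vanish, and if all
    d_n are 2 then A = -1/3 forces all digits to be 1.

    Conversely, points are shown to be incomplete sums by choosing digits one
    at a time ([digit_selection]): if sets K_n are uniformly bounded and every
    x in K_n has an allowed digit t for which - d_{n+1} x - t lies in K_{n+1},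
    then every point of K_0 is an incomplete sum. With K_n = [-2/3, 1/3] this
    gives case 3; with K_n the closure of the set of incomplete sums of the
    n-th shifted series it shows that sets of incomplete sums are closed.

    By the splitting formula M is the union, over the at most 2^k values h of
    the partial sums up to k, of the sets h + ((-1)^k / P_k) M', where M' is
    the set of incomplete sums of the shifted series
    ([incomplete_sums_split]). If the digits vanish beyond k, then M' = {0}
    and M is finite; if the tail is binary with all digits 1, then M' is a
    segment and M is a finite union of segments.

    In case 5, M is covered by 2^k intervals of length 2 / P_k, and
    2^k / P_k tends to 0 because a factor at most 2/3 occurs infinitely often;
    so M is null, and, being closed, nowhere dense. Changing a single far
    digit between 0 and e_n moves a point of M slightly, so M is perfect. For
    the cardinality, keep only nonzero digits with pairwise non-adjacent
    indices: the bounds -1 < A <= 1/2 show that distinct choices on such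
    indices have distinct sums ([alt_cantor_sparse_neq]), and reals inject
    into 0-1 sequences through their Dedekind cuts. *)

Set Implicit Arguments.
Unset Strict Implicit.
Unset Printing Implicit Defensive.

(** * Alternating Cantor series and their tails *)

(** As for all sequences here, index 0 carries no information. *)
Definition cantor_base (d : nat -> nat) : Prop :=
  forall n, (0 < n)%N -> (1 < d n)%N.

Definition cantor_digits (d e : nat -> nat) : Prop :=
  forall n, (0 < n)%N -> (e n < d n)%N.

(** [delta] selects an incomplete sum of the series with digits [e]. *)
Definition subdigits (e delta : nat -> nat) : Prop :=
  forall n, (0 < n)%N -> delta n = 0%N \/ delta n = e n.

(** The denominator [d 1 * ... * d n] of the [n]-th term. *)
Definition cantor_den {R : realType} (d : nat -> nat) (n : nat) : R :=
  \prod_(1 <= k < n.+1) (d k)%:R.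

Definition alt_partial_sum {R : realType} (d e : nat -> nat) (N : nat) : R :=
  \sum_(1 <= n < N.+1) ((-1) ^+ n * (e n)%:R / cantor_den d n).

(** Drops the terms of index 1 to [k]. *)
Definition shift (k : nat) (f : nat -> nat) : nat -> nat :=
  fun n => f (k + n)%N.

Lemma shift_base k d : cantor_base d -> cantor_base (shift k d).
Proof. by move=> hd n n0; apply: hd; rewrite addn_gt0 n0 orbT. Qed.

Lemma shift_digits k d e :
  cantor_digits d e -> cantor_digits (shift k d) (shift k e).
Proof. by move=> he n n0; apply: he; rewrite addn_gt0 n0 orbT. Qed.

Lemma shift_subdigits k e delta :
  subdigits e delta -> subdigits (shift k e) (shift k delta).
Proof. by move=> he n n0; apply: he; rewrite addn_gt0 n0 orbT. Qed.

Lemma subdigits_digits d e delta : cantor_base d ->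
  cantor_digits d e -> subdigits e delta -> cantor_digits d delta.
Proof.
move=> hd he hdelta n n0; case: (hdelta n n0) => ->; last exact: he.
exact: ltn_trans (hd n n0).
Qed.

Section PartialSums.
Context {R : realType}.
Implicit Types (d e delta : nat -> nat).

Local Notation P d n := (@cantor_den R d n).
Local Notation S d e N := (@alt_partial_sum R d e N).

Lemma cantor_den0 d : P d 0 = 1.
Proof. by rewrite /cantor_den big_geq. Qed.

Lemma cantor_denS d n : P d n.+1 = P d n * (d n.+1)%:R.
Proof. by rewrite /cantor_den big_nat_recr. Qed.

Lemma cantor_denD d k n : P d (k + n) = P d k * P (shift k d) n.
Proof.
elim: n => [|n IH]; first by rewrite addn0 cantor_den0 mulr1.
by rewrite addnS !cantor_denS IH -mulrA /shift addnS.
Qed.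

Lemma cantor_den_gt0 d n : cantor_base d -> 0 < P d n.
Proof.
move=> hd; elim: n => [|n IH]; first by rewrite cantor_den0.
by rewrite cantor_denS mulr_gt0// ltr0n (ltn_trans _ (hd n.+1 _)).
Qed.

Lemma cantor_den_exp d n : cantor_base d -> 2 ^+ n <= P d n.
Proof.
move=> hd; elim: n => [|n IH]; first by rewrite cantor_den0.
by rewrite cantor_denS exprSr ler_pM// ler_nat; exact: hd.
Qed.

Lemma inv_cantor_den_le d n : cantor_base d -> (P d n)^-1 <= 2^-1 ^+ n.
Proof.
move=> hd; rewrite exprVn lef_pV2 ?posrE ?exprn_gt0//.
  exact: cantor_den_exp.
exact: cantor_den_gt0.
Qed.

Lemma alt_partial_sum0 d e : S d e 0 = 0.
Proof. by rewrite /alt_partial_sum big_geq. Qed.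

Lemma alt_partial_sumS d e N :
  S d e N.+1 = S d e N + (-1) ^+ N.+1 * (e N.+1)%:R / P d N.+1.
Proof. by rewrite /alt_partial_sum big_nat_recr. Qed.

Lemma eq_cantor_den d d' n : (forall k, (0 < k)%N -> d k = d' k) ->
  P d n = P d' n.
Proof. by move=> dd; apply: eq_big_nat => k /andP[k0 _]; rewrite dd. Qed.

Lemma eq_alt_partial_sum d e e' N :
  (forall n, (0 < n <= N)%N -> e n = e' n) -> S d e N = S d e' N.
Proof. by move=> ee; apply: eq_big_nat => n n0; rewrite ee. Qed.

Lemma alt_partial_sumD d e k N :
  S d e (k + N) =
  S d e k + (-1) ^+ k / P d k * S (shift k d) (shift k e) N.
Proof.
elim: N => [|N IH]; first by rewrite addn0 alt_partial_sum0 mulr0 addr0.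
rewrite addnS !alt_partial_sumS IH mulrDr addrA -addnS cantor_denD exprD.
by rewrite /shift invfM; congr (_ + _); ring.
Qed.

Lemma alt_partial_sumSl d e N :
  S d e N.+1 = - ((e 1%N)%:R + S (shift 1 d) (shift 1 e) N) / (d 1%N)%:R.
Proof.
rewrite -add1n alt_partial_sumD alt_partial_sumS alt_partial_sum0 cantor_denS.
by rewrite cantor_den0 mul1r; ring.
Qed.

(** [x |-> - (t + x) / d 1] maps [[-1, 1]] to itself when [t <= d 1 - 1]. *)
Lemma alt_partial_sum_le1 d e N : cantor_base d -> cantor_digits d e ->
  `|S d e N| <= 1.
Proof.
elim: N d e => [|N IH] d e hd he; first by rewrite alt_partial_sum0 normr0.
have d0 : 0 < (d 1%N)%:R :> R by rewrite ltr0n (ltn_trans _ (hd 1%N _)).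
rewrite alt_partial_sumSl normrM normrN normfV [X in _ / X]gtr0_norm//.
rewrite ler_pdivrMr// mul1r (le_trans (ler_normD _ _))//.
have := IH _ _ (shift_base 1 hd) (shift_digits 1 he).
have : (e 1%N).+1%:R <= (d 1%N)%:R :> R by rewrite ler_nat; exact: he.
rewrite -natr1 normr_nat; lra.
Qed.

Lemma is_cvg_alt_partial_sum d e : cantor_base d -> cantor_digits d e ->
  cvgn (alt_partial_sum (R := R) d e).
Proof.
move=> hd he.
have -> : alt_partial_sum (R := R) d e =
    series (fun n => (-1) ^+ n.+1 * (e n.+1)%:R / P d n.+1).
  by apply/funext => N; rewrite /alt_partial_sum big_add1.
apply: normed_cvg.
apply: (@series_le_cvg _ _ (geometric 1 2^-1)) => [n|n|n|] //=.
- rewrite mul1r normrM normrM normrX normrN1 expr1n mul1r.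
  rewrite normfV [`|P _ _|]gtr0_norm ?cantor_den_gt0// ger0_norm//.
  rewrite (le_trans _ (inv_cantor_den_le n hd))//.
  have d0 : 0 < (d n.+1)%:R :> R by rewrite ltr0n (ltn_trans _ (hd n.+1 _)).
  have P0 := @cantor_den_gt0 d n hd.
  rewrite cantor_denS invfM mulrCA ger_pMr ?invr_gt0//.
  by rewrite ler_pdivrMr// mul1r ler_nat ltnW// he.
- by apply: is_cvg_geometric_series; rewrite ger0_norm ?invr_ge0//; lra.
Qed.

Lemma alt_cantor_splitD d e k : cantor_base d -> cantor_digits d e ->
  alt_cantor_series d e =
  S d e k + (-1) ^+ k / P d k * alt_cantor_series (shift k d) (shift k e).
Proof.
move=> hd he; apply: cvg_lim => //.
have hcv := is_cvg_alt_partial_sum (shift_base k hd)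
  (shift_digits k he).
rewrite -(cvg_shiftn k) /=.
under eq_fun do rewrite addnC -[\sum_(_ <= _ < _) _]/(S d e _) alt_partial_sumD.
by apply: cvgD; [exact: cvg_cst|apply: cvgMr].
Qed.

Lemma alt_cantor_split1 d e : cantor_base d -> cantor_digits d e ->
  alt_cantor_series d e =
  - ((e 1%N)%:R + alt_cantor_series (shift 1 d) (shift 1 e)) / (d 1%N)%:R :> R.
Proof.
move=> hd he; rewrite (alt_cantor_splitD 1 hd he) alt_partial_sumS.
by rewrite alt_partial_sum0 cantor_denS cantor_den0 mul1r; ring.
Qed.

Lemma eq_alt_cantor d d' e e' : (forall n, (0 < n)%N -> d n = d' n) ->
  (forall n, (0 < n)%N -> e n = e' n) ->
  alt_cantor_series d e = alt_cantor_series d' e' :> R.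
Proof.
move=> dd ee; congr (lim (_ @ \oo)); apply/funext => N.
apply: eq_big_nat => n /andP[n0 _]; rewrite ee//; congr (_ / _).
exact: eq_cantor_den.
Qed.

Lemma alt_cantor0 d e : (forall n, (0 < n)%N -> e n = 0%N) ->
  alt_cantor_series d e = 0 :> R.
Proof.
move=> e0; rewrite /alt_cantor_series.
rewrite (_ : (fun N => _) = cst 0) ?lim_cst//; apply/funext => N.
by rewrite big_nat big1// => n /andP[n0 _]; rewrite e0// mulr0 mul0r.
Qed.

Lemma alt_cantor_norm_le1 d e : cantor_base d -> cantor_digits d e ->
  `|alt_cantor_series d e : R| <= 1.
Proof.
move=> hd he; have hcv := is_cvg_alt_partial_sum hd he.
rewrite ler_norml; apply/andP; split.
- apply: limr_ge => //; apply: nearW => N.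
  by have := alt_partial_sum_le1 N hd he; rewrite ler_norml => /andP[].
- apply: limr_le => //; apply: nearW => N.
  by have := alt_partial_sum_le1 N hd he; rewrite ler_norml => /andP[].
Qed.

(** As the first term is nonpositive, only the rest, at most [1 / d 1],
    contributes; the strict lower bound [alt_cantor_gt] follows. *)
Lemma alt_cantor_le d e : cantor_base d -> cantor_digits d e ->
  alt_cantor_series d e <= 2^-1 :> R.
Proof.
move=> hd he; rewrite alt_cantor_split1//.
have d2 : 2 <= (d 1%N)%:R :> R by rewrite ler_nat hd.
have := alt_cantor_norm_le1 (shift_base 1 hd) (shift_digits 1 he).
rewrite ler_norml => /andP[h _].
have e0 : 0 <= (e 1%N)%:R :> R by [].
rewrite ler_pdivrMr; lra.
Qed.

Lemma alt_cantor_gt d e : cantor_base d -> cantor_digits d e ->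
  -1 < alt_cantor_series d e :> R.
Proof.
move=> hd he; rewrite alt_cantor_split1//.
have d2 : 2 <= (d 1%N)%:R :> R by rewrite ler_nat hd.
have h := alt_cantor_le (shift_base 1 hd) (shift_digits 1 he).
have : (e 1%N).+1%:R <= (d 1%N)%:R :> R by rewrite ler_nat; exact: he.
rewrite -natr1 => e1; rewrite ltr_pdivlMr; lra.
Qed.

Lemma alt_cantor_dist d e k : cantor_base d -> cantor_digits d e ->
  `|alt_cantor_series d e - S d e k| <= (P d k)^-1.
Proof.
move=> hd he; rewrite (alt_cantor_splitD k hd he) addrAC subrr add0r.
rewrite !normrM normrX normrN1 expr1n mul1r normfV.
rewrite [`|P _ _|]gtr0_norm ?cantor_den_gt0//.
rewrite ger_pMr ?invr_gt0 ?cantor_den_gt0//.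
exact: alt_cantor_norm_le1 (shift_base k hd) (shift_digits k he).
Qed.

(** If the sum is 0, the first digit is [- A] for the sum [A] of the shifted
    series, hence less than 1. *)
Lemma alt_cantor_eq0 d e : cantor_base d -> cantor_digits d e ->
  alt_cantor_series d e = 0 :> R -> forall n, (0 < n)%N -> e n = 0%N.
Proof.
move=> hd he h [//|n] _; elim: n d e hd he h => [|n IH] d e hd he;
  rewrite alt_cantor_split1// => h.
all: have hd' := shift_base 1 hd.
all: have he' := shift_digits 1 he.
all: have d0 : (d 1%N)%:R != 0 :> R
  by rewrite pnatr_eq0 -lt0n (ltn_trans _ (hd 1%N _)).
all: have h0 : (e 1%N)%:R + alt_cantor_series (shift 1 d) (shift 1 e) = 0 :> R
  by apply/eqP; move/eqP: h; rewrite mulf_eq0 oppr_eq0 invr_eq0 (negbTE d0)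
    orbF.
all: have hgt := alt_cantor_gt hd' he'.
all: have e0 : e 1%N = 0%N by
  apply/eqP; rewrite -leqn0 -ltnS -(ltr_nat R); lra.
- exact: e0.
- have := IH _ _ hd' he'; rewrite /shift; apply.
  by move: h0; rewrite e0 add0r.
Qed.

End PartialSums.

Lemma geometric_lt {R : realType} (c z r : R) : `|z| < 1 -> 0 < r ->
  exists N, forall n, (N <= n)%N -> c * z ^+ n < r.
Proof.
move=> z1 r0; have /cvgrPdist_lt/(_ _ r0)[N _ hN] := cvg_geometric c z1.
exists N => n /hN /=; rewrite sub0r normrN => h.
by rewrite (le_lt_trans _ h)// ler_norm.
Qed.

Lemma finite_set_nat_bounded (A : set nat) : finite_set A ->
  exists N, forall n, A n -> (n <= N)%N.
Proof.
move=> /finite_seqP[s ->]; exists (\max_(i <- s) i)%N => n ns.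
by apply: (@leq_bigmax_seq _ s xpredT id) => //.
Qed.

Lemma infinite_set_nat_unbounded (A : set nat) : ~ finite_set A ->
  forall m, exists2 n, (m <= n)%N & A n.
Proof.
move=> Ainf m; apply: contrapT => noA; apply: Ainf.
apply: sub_finite_set (finite_II m) => n An /=.
by rewrite ltnNge; apply/negP => mn; apply: noA; exists n.
Qed.

(** * Sets of incomplete sums *)

Section IncompleteSums.
Context {R : realType}.
Implicit Types (d e delta : nat -> nat).

Local Notation P d n := (@cantor_den R d n).
Local Notation S d e N := (@alt_partial_sum R d e N).
Local Notation M d e := (@incomplete_sums R d e).

Lemma alt_cantor_shift_inj d e e' k : cantor_base d ->
  cantor_digits d e -> cantor_digits d e' ->
  (forall n, (0 < n <= k)%N -> e n = e' n) ->
  alt_cantor_series d e = alt_cantor_series d e' :> R ->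
  alt_cantor_series (shift k d) (shift k e) =
  alt_cantor_series (shift k d) (shift k e') :> R.
Proof.
move=> hd he he' ee; rewrite !(alt_cantor_splitD k hd)//.
rewrite (eq_alt_partial_sum d ee) => /addrI/mulfI; apply.
by rewrite mulf_neq0 ?signr_eq0// invr_neq0// gt_eqF// cantor_den_gt0.
Qed.

(** The map [x |-> - d x - t] undoes the first step of the expansion: if [x] is
    a sum with first digit [t], its image is the sum of the shifted series. *)
Lemma digit_selection d e (K : nat -> set R) (C : R) :
  cantor_base d -> cantor_digits d e ->
  (forall n x, K n x -> `|x| <= C) ->
  (forall n x, K n x -> exists2 t, t = 0%N \/ t = e n.+1 &
    K n.+1 (- (d n.+1)%:R * x - t%:R)) ->
  K 0%N `<=` M d e.
Proof.
move=> hd he KC Kstep x Kx.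
have /choice[f fP] : forall p : nat * R, exists t, K p.1 p.2 ->
    (t = 0%N \/ t = e p.1.+1) /\ K p.1.+1 (- (d p.1.+1)%:R * p.2 - t%:R).
  move=> [n y] /=; have [Ky|nKy] := pselect (K n y); last by exists 0%N.
  by have [t] := Kstep _ _ Ky; exists t.
pose xs := fix xs n : R := if n is m.+1 then
  - (d m.+1)%:R * xs m - (f (m, xs m))%:R else x.
have Kxs n : K n (xs n) by elim: n => [//|n /(fP (_, _))[]].
pose delta n := f (n.-1, xs n.-1).
have hdelta : subdigits e delta.
  by move=> [//|n] _; have [] := fP (_, _) (Kxs n).
(* [xs n] is the remainder left to expand after [n] digits. *)
have xE n : x = S d delta n + (-1) ^+ n / P d n * xs n.
  elim: n => [|n IH].
    by rewrite alt_partial_sum0 cantor_den0 expr0 divr1 mul1r add0r.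
  rewrite [LHS]IH alt_partial_sumS cantor_denS [xs n.+1]/= /delta /= exprS.
  have P0 : P d n != 0 by rewrite gt_eqF// cantor_den_gt0.
  have d0 : (d n.+1)%:R != 0 :> R.
    by rewrite pnatr_eq0 -lt0n (ltn_trans _ (hd n.+1 _)).
  by field; rewrite P0 d0.
exists delta; first exact: hdelta.
have hdd := subdigits_digits hd he hdelta.
apply/eqP; rewrite -subr_eq0 -normr_le0; apply/ler_addgt0Pr => r r0.
have half1 : `|2^-1 : R| < 1 by rewrite ger0_norm ?invr_ge0//; lra.
have [N /(_ N (leqnn N)) hN] := geometric_lt (1 + C) half1 r0.
rewrite add0r (le_trans _ (ltW hN))//.
have iP := inv_cantor_den_le (R := R) N hd.
have P0 := cantor_den_gt0 (R := R) N hd.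
have h1 := alt_cantor_dist N hd hdd (R := R).
have h2 : `|S d delta N - x| <= C * 2^-1 ^+ N.
  rewrite [x in S d delta N - x](xE N) opprD addrA subrr add0r normrN.
  rewrite !normrM normrX normrN1 expr1n mul1r normfV.
  rewrite [`|P _ _|]gtr0_norm// mulrC.
  by rewrite ler_pM// ?invr_ge0 ?(ltW P0)//; exact: KC (Kxs N).
rewrite (le_trans (ler_distD (S d delta N) _ _))// mulrDl mul1r.
by rewrite lerD// (le_trans h1).
Qed.

Lemma incomplete_sums_norm_le1 d e x : cantor_base d -> cantor_digits d e ->
  M d e x -> `|x| <= 1.
Proof.
move=> hd he [delta hdelta <-]; apply: alt_cantor_norm_le1 => //.
exact: subdigits_digits hdelta.
Qed.

Lemma closed_incomplete_sums d e : cantor_base d -> cantor_digits d e ->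
  closed (M d e).
Proof.
move=> hd he; rewrite closure_id; apply/seteqP; split.
  exact: subset_closure.
apply: (@digit_selection _ _
  (fun n => closure (M (shift n d) (shift n e))) 1) => //.
  move=> n x; have sub : M (shift n d) (shift n e) `<=` [set y | `|y| <= 1].
    move=> y; exact: incomplete_sums_norm_le1 (shift_base n hd)
      (shift_digits n he).
  have cl : closed [set y : R | `|y| <= 1].
    apply: (@closed_comp _ _ (fun y : R => `|y|) [set z | z <= 1]) => [y _|].
      exact: norm_continuous.
    exact: closed_le.
  by move=> /(closure_subset sub); rewrite -(closure_id _).1.
move=> n x.
pose h (t : nat) (y : R) : R := - (d n.+1)%:R * y - t%:R.
pose B t := h t @^-1` closure (M (shift n.+1 d) (shift n.+1 e)).
have clB t : closed (B t).
  apply: closed_comp => [y _|]; last exact: closed_closure.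
  by apply: cvgB; [apply: cvgMr; exact: cvg_id|exact: cvg_cst].
(* A closure of a union of two sets is the union of their closures, so one of
   the two first digits works for every limit point. *)
have sub : M (shift n d) (shift n e) `<=` B 0%N `|` B (e n.+1).
  move=> _ [delta hdelta <-].
  have hdn := shift_base n hd; have hen := shift_digits n he.
  rewrite (alt_cantor_split1 hdn (subdigits_digits hdn hen hdelta)).
  have E : h (delta 1%N) (- ((delta 1%N)%:R + alt_cantor_series
     (shift 1 (shift n d)) (shift 1 delta)) / (shift n d 1%N)%:R) =
     alt_cantor_series (shift n.+1 d) (shift 1 delta).
    rewrite (@eq_alt_cantor R (shift n.+1 d) (shift 1 (shift n d))
      (shift 1 delta) (shift 1 delta))//; last first.
      by move=> m _; rewrite /shift; congr d; lia.
    rewrite /h /shift addn1.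
    have d0 : (d n.+1)%:R != 0 :> R.
      by rewrite pnatr_eq0 -lt0n (ltn_trans _ (hd n.+1 _)).
    by field.
  have hB : B (delta 1%N) (- ((delta 1%N)%:R + alt_cantor_series
     (shift 1 (shift n d)) (shift 1 delta)) / (shift n d 1%N)%:R).
    rewrite /B /= E; apply: subset_closure; exists (shift 1 delta) => //.
    move=> m m0; have := shift_subdigits 1 hdelta m0.
    by rewrite /shift => -[->|->]; [by left|right; congr e; lia].
  by move: hB; have [->|->] := hdelta 1%N isT; [left|right; rewrite -addn1].
move=> /(closure_subset sub); rewrite closureU => -[] hx;
  rewrite -(closure_id _).1 in hx; [|by []| |by []].
  by exists 0%N; [left|exact: hx].
by exists (e n.+1); [right|exact: hx].
Qed.

(** The values of the partial sums up to [k] over all choices of digits; there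
    are [2 ^ k] of them, counted with multiplicity. *)
Fixpoint head_sums d e k : seq R :=
  if k is j.+1 then head_sums d e j ++
    [seq h + (-1) ^+ k * (e k)%:R / P d k | h <- head_sums d e j]
  else [:: 0].

Lemma size_head_sums d e k : size (head_sums d e k) = (2 ^ k)%N.
Proof.
by elim: k => //= k IH; rewrite size_cat size_map IH expnS mul2n addnn.
Qed.

Lemma mem_head_sums d e k h : h \in head_sums d e k <->
  exists2 delta, subdigits e delta & h = S d delta k.
Proof.
elim: k h => [|k IH] h.
  rewrite /= inE; split=> [/eqP->|[delta _ ->]].
    by exists e; [right|rewrite alt_partial_sum0].
  by rewrite alt_partial_sum0.
rewrite [head_sums _ _ _]/= mem_cat; split.
- have ext delta t : subdigits e delta -> t = 0%N \/ t = e k.+1 ->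
      exists2 delta', subdigits e delta' & S d delta' k.+1 =
        S d delta k + (-1) ^+ k.+1 * t%:R / P d k.+1.
    move=> hdelta ht; exists (fun n => if n == k.+1 then t else delta n).
      by move=> n n0; case: eqP => [->//|_]; exact: hdelta.
    rewrite alt_partial_sumS eqxx; congr (_ + _); apply: eq_alt_partial_sum.
    by move=> n /andP[_ nk]; rewrite ltn_eqF.
  case/orP => [/IH[delta hdelta ->]|/mapP[g /IH[delta hdelta ->] ->]].
    have [|delta' h1 h2] := ext delta 0%N hdelta; first by left.
    by exists delta'; rewrite // h2 mulr0 mul0r addr0.
  have [|delta' h1 h2] := ext delta (e k.+1) hdelta; first by right.
  by exists delta'; rewrite // h2.
- move=> [delta hdelta ->]; rewrite alt_partial_sumS.
  have hS : S d delta k \in head_sums d e k by apply/IH; exists delta.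
  case: (hdelta k.+1 isT) => ->.
    by rewrite mulr0 mul0r addr0 hS.
  by apply/orP; right; apply/mapP; exists (S d delta k).
Qed.

(** A choice of the first [k] digits and a choice for the tail can be combined
    freely. *)
Lemma incomplete_sums_split d e k x : cantor_base d -> cantor_digits d e ->
  M d e x <-> exists h y, [/\ h \in head_sums d e k,
    M (shift k d) (shift k e) y & x = h + (-1) ^+ k / P d k * y].
Proof.
move=> hd he; split.
- move=> [delta hdelta <-].
  exists (S d delta k), (alt_cantor_series (shift k d) (shift k delta)); split.
  + by apply/mem_head_sums; exists delta.
  + by exists (shift k delta) => //; exact: shift_subdigits.
  + exact: alt_cantor_splitD (subdigits_digits hd he hdelta).
- move=> [h [y [/mem_head_sums[delta1 h1 ->] [delta2 h2 <-] ->]]].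
  pose delta n := if (n <= k)%N then delta1 n else delta2 (n - k)%N.
  have hdelta : subdigits e delta.
    move=> n n0; rewrite /delta; case: leqP => nk; first exact: h1.
    have := h2 (n - k)%N; rewrite subn_gt0 => /(_ nk).
    by rewrite /shift subnKC// ltnW.
  exists delta => //.
  rewrite (alt_cantor_splitD k hd (subdigits_digits hd he hdelta)).
  congr (_ + _ * _).
    by apply: eq_alt_partial_sum => n /andP[_ nk]; rewrite /delta nk.
  apply: eq_alt_cantor => // n n0.
  by rewrite /shift /delta addKn leqNgt -[X in (X < _)%N]addn0 ltn_add2l n0.
Qed.

Lemma finite_incomplete_sums d e : cantor_base d -> cantor_digits d e ->
  finite_set [set n | (0 < n)%N /\ e n <> 0%N] -> finite_set (M d e).
Proof.
move=> hd he /finite_set_nat_bounded[N hN].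
apply: (@sub_finite_set _ _ [set` head_sums d e N]); last exact: finite_seq.
move=> x /(incomplete_sums_split N x hd he)[h [_ [hh [delta hdelta <-] ->]]] /=.
rewrite alt_cantor0 ?mulr0 ?addr0// => n n0.
suff e0 : e (N + n)%N = 0%N by case: (hdelta n n0) => -> //.
apply: contrapT => en; have Nn0 : (0 < N + n)%N by rewrite addn_gt0 n0 orbT.
by have := hN _ (conj Nn0 en); lia.
Qed.

End IncompleteSums.

(** * Binary bases *)

Section Binary.
Context {R : realType}.
Implicit Types (d e delta : nat -> nat).

Local Notation P d n := (@cantor_den R d n).
Local Notation S d e N := (@alt_partial_sum R d e N).
Local Notation M d e := (@incomplete_sums R d e).

Definition binary_base d : Prop := forall n, (0 < n)%N -> d n = 2%N.

Lemma binary_cantor_base d : binary_base d -> cantor_base d.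
Proof. by move=> hd n n0; rewrite hd. Qed.

Lemma shift_binary k d : binary_base d -> binary_base (shift k d).
Proof. by move=> hd n n0; apply: hd; rewrite addn_gt0 n0 orbT. Qed.

(** For the constant base 2 the series of ones is its own shift. *)
Lemma alt_cantor_binary_ones d : binary_base d ->
  alt_cantor_series d (fun=> 1%N) = - (1 / 3) :> R.
Proof.
move=> hd; rewrite (@eq_alt_cantor R d (fun=> 2%N) _ (fun=> 1%N))//.
have h : alt_cantor_series (fun=> 2%N) (fun=> 1%N) =
    - (1 + alt_cantor_series (fun=> 2%N) (fun=> 1%N)) / 2 :> R.
  by rewrite [LHS]alt_cantor_split1.
lra.
Qed.

(** If [e 1 = 0], the shifted series would have sum 2/3, above the bound 1/2. *)
Lemma alt_cantor_binary_third_ones d e : binary_base d -> cantor_digits d e ->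
  alt_cantor_series d e = - (1 / 3) :> R -> forall n, (0 < n)%N -> e n = 1%N.
Proof.
move=> hd he h [//|n] _; elim: n d e hd he h => [|n IH] d e hd he h.
all: have hb := binary_cantor_base hd.
all: have hd' := shift_binary 1 hd.
all: have he' := shift_digits 1 he.
all: move: h; rewrite alt_cantor_split1// (hd 1%N)// => h.
all: have hle := alt_cantor_le (R := R) (binary_cantor_base hd') he'.
all: have e1 : e 1%N = 1%N by
  have := he 1%N isT; rewrite (hd 1%N isT); case: (e 1%N) h => [|[|//]] // h _;
  exfalso; lra.
- exact: e1.
- by apply: (IH _ _ hd' he'); move: h; rewrite e1; lra.
Qed.

Lemma alt_partial_sum_binary d e N : binary_base d -> cantor_digits d e ->
  - (2 / 3) <= S d e N <= 1 / 3.
Proof.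
elim: N d e => [|N IH] d e hd he; first by rewrite alt_partial_sum0; lra.
have := IH _ _ (shift_binary 1 hd) (shift_digits 1 he).
rewrite alt_partial_sumSl hd//; have := he 1%N isT; rewrite hd//.
by case: (e 1%N) => [|[|//]] _; lra.
Qed.

Lemma incomplete_sums_binary d e : binary_base d ->
  (forall n, (0 < n)%N -> e n = 1%N) ->
  M d e = `[- (2 / 3), 1 / 3]%classic.
Proof.
move=> hd e1; have hb := binary_cantor_base hd.
have he : cantor_digits d e by move=> n n0; rewrite e1// hd.
apply/seteqP; split.
- move=> _ [delta hdelta <-] /=; rewrite in_itv /=.
  have hdd := subdigits_digits hb he hdelta.
  have hcv := is_cvg_alt_partial_sum (R := R) hb hdd.
  by apply/andP; split; [apply: limr_ge|apply: limr_le] => //;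
    apply: nearW => N; have /andP[] := alt_partial_sum_binary N hd hdd.
- apply: (@digit_selection _ _ _ (fun=> `[- (2 / 3), 1 / 3]%classic) 1) => //.
    by move=> _ x /=; rewrite in_itv /= ler_norml; lra.
  move=> n x /=; rewrite in_itv /= hd// e1// => /andP[hx1 hx2].
  (* -1/6 is the midpoint, the common end of the images of the segment under
     the two maps [y |-> - (t + y) / 2]. *)
  have [hx|hx] := ltP x (- (1 / 6)).
    by exists 1%N; [right|rewrite in_itv /=; lra].
  by exists 0%N; [left|rewrite in_itv /=; lra].
Qed.

Lemma is_segment_affine (h c : R) : c != 0 ->
  is_segment [set x | exists2 y, `[- (2 / 3), 1 / 3]%classic y & x = h + c * y].
Proof.
move=> c0; have [cn|cp] := ltP c 0.
- exists (h + c * (1 / 3)), (h + c * - (2 / 3)); split; first by nra.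
  apply/seteqP; split => [_ [y /= + ->]|x /=]; rewrite !in_itv /=.
    by move=> /andP[y1 y2]; apply/andP; split; nra.
  move=> /andP[x1 x2]; exists ((x - h) / c); last by field.
  rewrite in_itv /=; apply/andP.
  by split; [rewrite ler_ndivlMr//|rewrite ler_ndivrMr//]; lra.
- have {c0}cp : 0 < c by rewrite lt_neqAle eq_sym c0.
  exists (h + c * - (2 / 3)), (h + c * (1 / 3)); split; first by nra.
  apply/seteqP; split => [_ [y /= + ->]|x /=]; rewrite !in_itv /=.
    by move=> /andP[y1 y2]; apply/andP; split; nra.
  move=> /andP[x1 x2]; exists ((x - h) / c); last by field; rewrite gt_eqF.
  rewrite in_itv /=; apply/andP.
  by split; [rewrite ler_pdivlMr//|rewrite ler_pdivrMr//]; lra.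
Qed.

Lemma incomplete_sums_eventually_binary d e k :
  cantor_base d -> cantor_digits d e ->
  (forall n, (k < n)%N -> d n = 2%N) -> (forall n, (k < n)%N -> e n = 1%N) ->
  finite_union_of_segments (M d e).
Proof.
move=> hd he d2 e1; pose c := (-1) ^+ k / P d k.
have c0 : c != 0.
  by rewrite mulf_neq0 ?signr_eq0// invr_neq0// gt_eqF// cantor_den_gt0.
pose seg (h : R) :=
  [set x | exists2 y, `[- (2 / 3), 1 / 3]%classic y & x = h + c * y].
exists (seg @` [set` head_sums d e k]); split.
- exact/finite_image/finite_seq.
- by move=> _ [h _ <-]; exact: is_segment_affine.
- rewrite bigcup_image.
  have Mk : M (shift k d) (shift k e) = `[- (2 / 3), 1 / 3]%classic.
    by apply: incomplete_sums_binary => n n0; [apply: d2|apply: e1];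
      rewrite -[X in (X < _)%N]addn0 ltn_add2l.
  apply/seteqP; split=> x.
    move=> /(incomplete_sums_split k x hd he)[h [y [hh My ->]]].
    by exists h => //; exists y => //; rewrite -Mk.
  move=> [h hh [y hy ->]]; apply/(incomplete_sums_split k _ hd he).
  by exists h, y; rewrite Mk.
Qed.

Lemma sorted_ltn_le_last (m : seq nat) n :
  sorted ltn m -> n \in m -> (n <= last 0%N m)%N.
Proof.
elim/last_ind: m n => [//|m a _] n.
rewrite last_rcons -cats1 (sorted_pairwise ltn_trans) pairwise_cat.
rewrite mem_cat inE => /and3P[/allrelP h _ _] /orP[nm|/eqP->//].
by apply: ltnW; apply: h => //; rewrite inE.
Qed.

(** Cancelling the common partial sums up to [k] leaves a binary series with
    sum -1/3. *)
Lemma eventually_ones d e k : cantor_base d -> cantor_digits d e ->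
  (forall n, (k < n)%N -> d n = 2%N) ->
  alt_cantor_series d e =
  alt_cantor_series d (fun n => if (n <= k)%N then e n else 1%N) :> R ->
  forall n, (k < n)%N -> e n = 1%N.
Proof.
move=> hd he d2 h n kn.
have he' : cantor_digits d (fun n => if (n <= k)%N then e n else 1%N).
  by move=> j j0; case: ifP => _; [exact: he|exact: hd].
have hb : binary_base (shift k d).
  by move=> j j0; apply: d2; rewrite -[X in (X < _)%N]addn0 ltn_add2l.
have {h} := alt_cantor_shift_inj (k := k) hd he he' _ h.
rewrite (@eq_alt_cantor R (shift k d) (shift k d)
  (shift k (fun n => if (n <= k)%N then e n else 1%N)) (fun=> 1%N))//;
  last first.
  by move=> j j0; rewrite /shift leqNgt -[X in (X < _)%N]addn0 ltn_add2l j0.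
rewrite alt_cantor_binary_ones// => h.
have nk0 : (0 < n - k)%N by rewrite subn_gt0.
have : alt_cantor_series (shift k d) (shift k e) = - (1 / 3) :> R.
  by apply: h => j /andP[_ jk]; rewrite jk.
move=> /(alt_cantor_binary_third_ones hb (shift_digits k he)) /(_ _ nk0).
by rewrite /shift subnKC// ltnW.
Qed.

End Binary.

(** * Measure and density *)

Section ZeroMeasure.
Context {R : realType}.
Implicit Types (d e delta : nat -> nat).

Local Notation P d n := (@cantor_den R d n).
Local Notation S d e N := (@alt_partial_sum R d e N).
Local Notation M d e := (@incomplete_sums R d e).
Local Notation mu := (@lebesgue_measure R).

(** The closed [r]-neighbourhood of the entries of [L]. *)
Definition near_seq (L : seq R) (r : R) : set R :=
  [set x | exists2 h, h \in L & `|x - h| <= r].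

Lemma measure_near_seq (L : seq R) (r : R) : 0 < r ->
  measurable (near_seq L r) /\
  (mu (near_seq L r) <= ((size L)%:R * (2 * r))%:E)%E.
Proof.
move=> r0; elim: L => [|h L [mL IH]].
  have -> : near_seq [::] r = set0 by apply/seteqP; split=> x // [].
  by rewrite measure0 mul0r.
have -> : near_seq (h :: L) r = `[h - r, h + r]%classic `|` near_seq L r.
  have E x : (`|x - h| <= r) = (x \in `[h - r, h + r]).
    by rewrite in_itv /= ler_distlC; apply/idP/idP; lra.
  apply/seteqP; split => x.
    move=> [g]; rewrite inE => /orP[/eqP->|gL]; last by right; exists g.
    by rewrite E; left.
  move=> [xh|[g gL xg]]; first by exists h; rewrite ?mem_head// E.
  by exists g => //; rewrite inE gL orbT.
have mI : measurable (`[h - r, h + r]%classic : set R).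
  exact: measurable_itv.
split; first exact: measurableU.
have muI : mu `[h - r, h + r]%classic = (2 * r)%:E.
  rewrite lebesgue_measure_itv /= lte_fin ifT; last by lra.
  by rewrite -EFinB; congr (_%:E); lra.
rewrite (le_trans (measureU2 mu mI mL))//.
rewrite [size (h :: L)]/= -nat1r mulrDl mul1r EFinD -muI.
exact: leeD.
Qed.

Lemma power2_div_den_nonincreasing d k n : cantor_base d -> (k <= n)%N ->
  2 ^+ n / P d n <= 2 ^+ k / P d k.
Proof.
move=> hd; elim: n => [|n IH]; first by rewrite leqn0 => /eqP->.
rewrite leq_eqVlt => /orP[/eqP->//|/IH]; apply: le_trans.
have P0 := cantor_den_gt0 (R := R) n hd.
have d2 : 2 <= (d n.+1)%:R :> R by rewrite ler_nat hd.
rewrite exprSr cantor_denS invfM mulrACA ger_pMr ?divr_gt0 ?exprn_gt0//.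
by rewrite ler_pdivrMr; lra.
Qed.

Lemma power2_div_den_small d j : cantor_base d ->
  ~ finite_set [set n | (0 < n)%N /\ (2 < d n)%N] ->
  exists k, 2 ^+ k / P d k <= (2 / 3) ^+ j.
Proof.
move=> hd dinf; elim: j => [|j [k IH]].
  by exists 0%N; rewrite cantor_den0 divr1.
have [[|n]] := infinite_set_nat_unbounded dinf k.+1; first by [].
rewrite ltnS => kn [_ dn].
exists n.+1; have := power2_div_den_nonincreasing hd kn.
have P0 := cantor_den_gt0 (R := R) n hd.
have d3 : 3 <= (d n.+1)%:R :> R by rewrite ler_nat.
move=> /le_trans /(_ IH) h.
rewrite [2 ^+ n.+1]exprSr [(2 / 3) ^+ _]exprSr cantor_denS invfM mulrACA.
apply: ler_pM => //; first by rewrite divr_ge0 ?exprn_ge0// ltW.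
by rewrite ler_pdivrMr; lra.
Qed.

Lemma incomplete_sums_near d e k : cantor_base d -> cantor_digits d e ->
  M d e `<=` near_seq (head_sums d e k) (P d k)^-1.
Proof.
move=> hd he _ [delta hdelta <-].
exists (S d delta k); first by apply/mem_head_sums; exists delta.
exact: alt_cantor_dist (subdigits_digits hd he hdelta).
Qed.

Lemma incomplete_sums_measure0 d e : cantor_base d -> cantor_digits d e ->
  ~ finite_set [set n | (0 < n)%N /\ (2 < d n)%N] ->
  mu (M d e) = 0%E.
Proof.
move=> hd he dinf; apply/eqP; rewrite eq_le measure_ge0 andbT.
apply/lee_addgt0Pr => r r0; rewrite add0e.
have z1 : `|2 / 3 : R| < 1 by rewrite ger0_norm; lra.
have [j /(_ j (leqnn j)) hj] := geometric_lt 2 z1 r0.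
have [k hk] := power2_div_den_small j hd dinf.
have Pk0 : 0 < (P d k)^-1 by rewrite invr_gt0 cantor_den_gt0.
have [mN leN] := measure_near_seq (head_sums d e k) Pk0.
have mM : measurable (M d e).
  by apply: closed_measurable; exact: closed_incomplete_sums.
apply: le_trans (le_trans leN _).
  by apply: le_measure; rewrite ?inE//; exact: incomplete_sums_near.
rewrite lee_fin size_head_sums natrX mulrCA; apply: le_trans (ltW hj).
by rewrite ler_pM2l.
Qed.

Lemma closed_measure0_nowhere_dense (A : set R) :
  closed A -> mu A = 0%E -> nowhere_dense A.
Proof.
move=> cA A0; rewrite /nowhere_dense -(closure_id A).1//.
apply/seteqP; split=> // x /nbhs_ballP[r /= r0 rA].
have : (mu (ball x r) <= mu A)%E.
  apply: le_measure => //; rewrite inE; first exact: measurable_ball.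
  exact: closed_measurable.
rewrite A0 (lebesgue_measure_ball x (ltW r0)) lee_fin.
by rewrite leNgt pmulrn_lgt0// r0.
Qed.

End ZeroMeasure.

(** * Perfectness *)

Section Perfect.
Context {R : realType}.
Implicit Types (d e delta : nat -> nat).

Local Notation M d e := (@incomplete_sums R d e).

Lemma alt_cantor_flip_neq d e e' k : cantor_base d ->
  cantor_digits d e -> cantor_digits d e' ->
  (forall n, (0 < n)%N -> n != k.+1 -> e n = e' n) -> e k.+1 <> e' k.+1 ->
  alt_cantor_series d e <> alt_cantor_series d e' :> R.
Proof.
move=> hd he he' ee neq h.
have := alt_cantor_shift_inj (k := k) hd he he' _ h.
rewrite !(alt_cantor_split1 (shift_base k hd))//; try exact: shift_digits.
have d0 : (shift k d 1)%:R != 0 :> R.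
  by rewrite pnatr_eq0 -lt0n (ltn_trans _ (shift_base k hd _)).
move=> /(_ _)/mulIf; rewrite invr_eq0 d0 => h1.
have : - ((shift k e 1)%:R + alt_cantor_series (shift 1 (shift k d))
    (shift 1 (shift k e))) = - ((shift k e' 1)%:R + alt_cantor_series
    (shift 1 (shift k d)) (shift 1 (shift k e'))) :> R.
  by apply: h1 => // n /andP[n0 nk]; apply: ee; lia.
rewrite (@eq_alt_cantor R _ (shift 1 (shift k d)) _ (shift 1 (shift k e')))//.
  by move=> /oppr_inj /addIr /eqP; rewrite eqr_nat /shift addn1 => /eqP.
by move=> n n0; apply: ee; lia.
Qed.

Lemma incomplete_sums_limit_point d e : cantor_base d -> cantor_digits d e ->
  ~ finite_set [set n | (0 < n)%N /\ e n <> 0%N] ->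
  M d e `<=` limit_point (M d e).
Proof.
move=> hd he einf _ [delta hdelta <-] U /nbhs_ballP[r /= r0 rU].
have hdd := subdigits_digits hd he hdelta.
have half1 : `|2^-1 : R| < 1 by rewrite ger0_norm ?invr_ge0//; lra.
have [N hN] := geometric_lt 2 half1 r0.
have [[//|n]] := infinite_set_nat_unbounded einf N.+1.
rewrite ltnS => Nn [_ en].
(* Exchanges the two allowed values 0 and [e] of the digit of index n + 1. *)
pose delta' m := if m == n.+1 then (e m - delta m)%N else delta m.
have hdelta' : subdigits e delta'.
  move=> m m0; rewrite /delta'; case: eqP => _; last exact: hdelta.
  by have [->|->] := hdelta m m0; [right; rewrite subn0|left; rewrite subnn].
have hdd' := subdigits_digits hd he hdelta'.
exists (alt_cantor_series d delta'); split; last 2 first.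
- by exists delta'.
- apply: rU; rewrite /ball /=; apply: le_lt_trans (hN n Nn).
  rewrite (le_trans (ler_distD (alt_partial_sum d delta n) _ _))// mulrDl.
  have h1 := alt_cantor_dist n hd hdd (R := R).
  have := alt_cantor_dist n hd hdd' (R := R).
  rewrite (@eq_alt_partial_sum R d delta' delta) => [|m /andP[_ mn]];
    last first.
    by rewrite /delta' ltn_eqF.
  move=> h2; rewrite mul1r [X in _ + X]distrC.
  have hP := inv_cantor_den_le (R := R) n hd.
  by apply: lerD; [apply: le_trans h1 hP|apply: le_trans h2 hP].
- apply/eqP; apply: (@alt_cantor_flip_neq _ _ _ n) => //.
    by move=> m m0 /negbTE mn; rewrite /delta' mn.
  rewrite /delta' eqxx; have [->|->] := hdelta n.+1 isT; first by rewrite subn0.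
  by rewrite subnn => /esym.
Qed.

Lemma perfect_incomplete_sums d e : cantor_base d -> cantor_digits d e ->
  ~ finite_set [set n | (0 < n)%N /\ e n <> 0%N] -> perfect_set (M d e).
Proof.
move=> hd he einf; have cM := closed_incomplete_sums (R := R) hd he.
split=> //; apply/seteqP; split; last exact: incomplete_sums_limit_point.
by move=> x /subset_limit_point; rewrite -(closure_id _).1.
Qed.

End Perfect.

(** * Cardinality *)

Section Continuum.
Context {R : realType}.
Implicit Types (d e delta : nat -> nat).

Local Notation M d e := (@incomplete_sums R d e).

(** Where the two digit sequences first differ, the terms differ by at least
    the inverse of the denominator; as the next digits vanish, the remaining
    tails differ by less than [3/2 / d k.+2] times as much, which is at most
    3/4 of it. *)
Lemma alt_cantor_sparse_neq d e e' k : cantor_base d ->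
  cantor_digits d e -> cantor_digits d e' ->
  (forall n, (0 < n <= k)%N -> e n = e' n) ->
  e k.+1 = 0%N -> e' k.+1 <> 0%N -> e k.+2 = 0%N -> e' k.+2 = 0%N ->
  alt_cantor_series d e <> alt_cantor_series d e' :> R.
Proof.
move=> hd he he' ee e1 e1' e2 e2' h.
have {h} := alt_cantor_shift_inj (k := k) hd he he' ee h.
have hk := shift_base k hd; have hek := shift_digits k he.
have hek' := shift_digits k he'.
have hk1 := shift_base 1 hk; have hek1 := shift_digits 1 hek.
have hek1' := shift_digits 1 hek'.
have hk2 := shift_base 1 hk1; have hek2 := shift_digits 1 hek1.
have hek2' := shift_digits 1 hek1'.
rewrite !(alt_cantor_split1 hk)// !(alt_cantor_split1 hk1)//.
have -> : shift k e 1 = 0%N by rewrite /shift addn1.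
have -> : shift 1 (shift k e) 1 = 0%N by rewrite /shift addn2.
have -> : shift 1 (shift k e') 1 = 0%N by rewrite /shift addn2.
have d0 : (shift k d 1)%:R != 0 :> R.
  by rewrite pnatr_eq0 -lt0n (ltn_trans _ (hk 1%N _)).
move/mulIf; rewrite invr_eq0 d0 => /(_ isT)/oppr_inj.
have h1 := alt_cantor_gt hk2 hek2 (R := R).
have h2 := alt_cantor_le hk2 hek2 (R := R).
have h1' := alt_cantor_gt hk2 hek2' (R := R).
have h2' := alt_cantor_le hk2 hek2' (R := R).
have d2 : 2 <= (shift 1 (shift k d) 1)%:R :> R by rewrite ler_nat hk1.
have e1k : 1 <= (shift k e' 1)%:R :> R.
  by rewrite ler1n lt0n /shift addn1; apply/eqP.
move: h1 h2 h1' h2' d2 e1k.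
set x := alt_cantor_series _ _; set y := alt_cantor_series _ _.
set D := (shift 1 _ _)%:R; set E := (shift k e' 1)%:R.
move=> x1 x2 y1 y2 D2 E1; rewrite !add0r => /eqP; apply/negP.
rewrite lt_eqF//.
have D0 : D != 0 by rewrite gt_eqF//; lra.
rewrite -subr_gt0.
have -> : E + - y / D - - x / D = (E * D - y + x) / D by field.
by apply: divr_gt0; nra.
Qed.

(** Keeps the digit of index [f k.*2] if [b k], and drops all others. Taking
    only the even terms of an increasing [f] makes the kept indices pairwise
    non-adjacent. *)
Definition sparse_digits e (f : nat -> nat) (b : nat -> bool) (n : nat) : nat :=
  if `[< exists2 k, f k.*2 = n & b k >] then e n else 0%N.

Lemma sparse_digits_sub e f b : subdigits e (sparse_digits e f b).
Proof. by move=> n _; rewrite /sparse_digits; case: ifP; [right|left]. Qed.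

Lemma alt_cantor_sparse_inj d e f b b' : cantor_base d -> cantor_digits d e ->
  increasing_seq f -> (forall k, (0 < f k)%N) -> (forall k, e (f k) <> 0%N) ->
  alt_cantor_series d (sparse_digits e f b) =
  alt_cantor_series d (sparse_digits e f b') :> R ->
  b =1 b'.
Proof.
move=> hd he finc f0 ef.
have fle i j : (f i <= f j)%N = (i <= j)%N by exact: finc.
have flt i j : (f i < f j)%N = (i < j)%N by rewrite !ltnNge fle.
have finj i j : f i = f j -> i = j.
  by move=> fij; apply/eqP; rewrite eqn_leq -(fle i) -(fle j) fij leqnn.
have value c k : sparse_digits e f c (f k.*2) = if c k then e (f k.*2) else 0%N.
  rewrite /sparse_digits; congr (if _ then _ else _).
  apply/asboolP/idP => [|ck].
    by move=> [j /finj/double_inj ->].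
  by exists k.
have gap c k : sparse_digits e f c (f k.*2).+1 = 0%N.
  rewrite /sparse_digits asboolF// => -[j fj _].
  have kj : (k.*2 < j.*2)%N by rewrite -flt fj.
  have h1 : (f k.*2 < f k.*2.+1)%N by rewrite flt.
  have h2 : (f k.*2.+1 < f j.*2)%N.
    by rewrite flt -[_.+2]/(k.+1.*2) leq_double -ltn_double.
  by move: (leq_ltn_trans h1 h2); rewrite fj ltnn.
move=> h; apply: contrapT => /existsNP[i0 bi0].
have /ex_minnP[k bk kmin] : exists k, b k != b' k by exists i0; apply/eqP.
wlog bk0 : b b' h i0 bi0 bk kmin / b k = false => [wl|].
  case bkE : (b k); last by apply: wl bkE; try exact: h; try exact: bi0.
  apply: (wl b' b (esym h) i0) => [E||j|].
  - exact/bi0/esym.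
  - by rewrite eq_sym.
  - by rewrite eq_sym; exact: kmin.
  - by move: bk; rewrite bkE; case: (b' k).
have b'k : b' k by move: bk; rewrite bk0; case: (b' k).
have fE : (f k.*2).-1.+1 = f k.*2 by rewrite prednK.
move: h; apply: (@alt_cantor_sparse_neq _ _ _ (f k.*2).-1) => //; rewrite ?fE.
- by apply: subdigits_digits he _ => //; exact: sparse_digits_sub.
- by apply: subdigits_digits he _ => //; exact: sparse_digits_sub.
- move=> n /andP[n0 nk]; rewrite /sparse_digits.
  have E j : f j.*2 = n -> b j = b' j.
    move=> fj; apply/eqP/negPn/negP => /kmin kj.
    have : (f j.*2 < f k.*2)%N by rewrite fj; move: (f0 k.*2); lia.
    by rewrite flt ltn_double ltnNge kj.
  congr (if _ then _ else _).
  apply/asboolP/asboolP => -[j fj bj]; exists j => //.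
    by rewrite -E.
  by rewrite E.
- by rewrite value bk0.
- by rewrite value b'k.
- exact: gap.
- exact: gap.
Qed.

Lemma incomplete_sums_card d e : cantor_base d -> cantor_digits d e ->
  ~ finite_set [set n | (0 < n)%N /\ e n <> 0%N] ->
  (M d e #= [set: R])%card.
Proof.
move=> hd he einf; rewrite card_eq_le subset_card_le//=.
have [|f [finc _ fA]] := infinite_increasing_seq_wf _ einf 0%N.
  move=> x; apply: sub_finite_set (finite_II x.+1) => y /=.
  by rewrite ltnS.
(* The rationals below [r], through an enumeration of the rationals. *)
pose cut (r : R) k := if unpickle k is Some q then ratr q < r else false.
have cut_inj r s : r < s -> ~ (cut r =1 cut s).
  move=> /rat_in_itvoo[q]; rewrite in_itv /= => /andP[rq qs] /(_ (pickle q)).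
  by rewrite /cut pickleK qs lt_gtF.
pose g r : R := alt_cantor_series d (sparse_digits e f (cut r)).
have gM r : M d e (g r).
  by exists (sparse_digits e f (cut r)) => //; exact: sparse_digits_sub.
have ginj : injective g.
  move=> r s /(alt_cantor_sparse_inj hd he finc) h.
  have {}h : cut r =1 cut s by apply: h => k; have [] := fA k.
  have [/cut_inj//|/cut_inj|//] := ltgtP r s.
  by case=> k; rewrite h.
have <- : g @^-1` (M d e) = setT by apply/seteqP; split=> r _ //; exact: gM.
by apply: card_ge_preimage => r s _ _; exact: ginj.
Qed.

End Continuum.

Unset Implicit Arguments.

(** * The structure of the set of incomplete sums *)

Theorem theorem10 (R : realType) (d eps : nat -> nat) (s0 : R)
    (hd : forall n, (0 < n)%N -> (1 < d n)%N)
    (heps : forall n, (0 < n)%N -> (eps n < d n)%N)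
    (hs0 : s0 = alt_cantor_series d eps) :
  let M : set R := incomplete_sums d eps in
  [/\ (* 1 *)
      s0 = 0 -> M = [set 0],
      (* 2 *)
      finite_set [set n | (0 < n)%N /\ eps n <> 0%N] -> finite_set M,
      (* 3 *)
      (forall n, (0 < n)%N -> d n = 2%N) -> s0 = - (1 / 3) ->
        M = `[- (2 / 3), 1 / 3]%classic,
      (* 4: m lists m_1 < ... < m_k0, and last 0 m is m_k0 *)
      forall m : seq nat,
        m <> [::] -> sorted ltn m ->
        (forall n, n \in m <-> (0 < n)%N /\ d n <> 2%N) ->
        s0 = alt_cantor_series d
               (fun n => if (n <= last 0%N m)%N then eps n else 1%N) ->
        finite_union_of_segments M
    & (* 5: the remaining case, that is, outside the hypothesis of 2 *)
      ~ finite_set [set n | (0 < n)%N /\ eps n <> 0%N] ->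
      s0 <> 0 -> infinite_set [set n | (0 < n)%N /\ (2 < d n)%N] ->
        [/\ (M #= [set: R])%card, perfect_set M, nowhere_dense M
          & lebesgue_measure M = 0%E]].
Proof.
move=> M; split.
- rewrite hs0 => /(alt_cantor_eq0 hd heps) e0; apply/seteqP; split=> [x|x ->].
    move=> [delta hdelta <-]; apply: alt_cantor0 => n n0.
    by case: (hdelta n n0) => ->; rewrite ?e0.
  by exists eps; [right|exact: alt_cantor0].
- exact: finite_incomplete_sums.
- rewrite hs0 => d2 third; apply: incomplete_sums_binary => //.
  exact: alt_cantor_binary_third_ones third.
- move=> m _ msorted mP s0E.
  have d2 n : (last 0%N m < n)%N -> d n = 2%N.
    move=> mn; apply: contrapT => dn2.
    have /(sorted_ltn_le_last msorted) : n \in m.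
      by apply/mP; split=> //; exact: leq_ltn_trans mn.
    by rewrite leqNgt mn.
  apply: (incomplete_sums_eventually_binary hd heps d2).
  by apply: (@eventually_ones R _ _ _ hd heps d2); rewrite -hs0.
- move=> einf _ dinf.
  have mM0 := incomplete_sums_measure0 hd heps dinf (R := R).
  split=> //.
  + exact: incomplete_sums_card.
  + exact: perfect_incomplete_sums.
  + apply: closed_measure0_nowhere_dense => //.
    exact: closed_incomplete_sums.
Qed.
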